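(* Let $R$ be an associative ring with identity and let $a,b\in R$. If $ab$ is strongly clean in $R$, then $ba$ is strongly clean in $R$.
   Context: $U(R)$ denotes the group of units of $R$. An element $x\in R$ is strongly clean if there exists an idempotent $e^2=e\in R$ with $ex=xe$ and $x-e\in U(R)$. *)

(* Defs.v *)
From mathcomp Require Import all_boot all_algebra.

Set Implicit Arguments.
Unset Strict Implicit.
Unset Printing Implicit Defensive.

Import GRing.Theory.
Local Open Scope ring_scope.

(* [GRing.unit] needs a [unitRingType], that is, a nontrivial ring whose units
   are decidable; invertibility is spelled out so that every ring is covered. *)
Definition is_unit (R : pzRingType) (u : R) : Prop :=
  exists v : R, v * u = 1 /\ u * v = 1.

Definition strongly_clean (R : pzRingType) (x : R) : Prop :=
  exists e : R, [/\ e * e = e, e * x = x * e & is_unit (x - e)].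

(* Main.v *)
(* Write x = ab, let e be an idempotent commuting with x, and let w be the
   inverse of x - e. Then c = (1 - e)w inverts x on the corner of 1 - e, where e
   vanishes, so bca is an idempotent commuting with ba. Its complement
   1 - bca is the idempotent for ba: ba - (1 - bca) = b(1 + c)a - 1 has inverse
   bw(1 + c)a - 1, because xw(1 + c) = (1 + ew)(1 + (1 - e)w) = 1 + w. *)
Require Import Defs.
From mathcomp Require Import all_boot all_algebra.

Set Implicit Arguments.
Unset Strict Implicit.
Unset Printing Implicit Defensive.

Import GRing.Theory.
Local Open Scope ring_scope.

(** The hypothesis turns the quadratic term of the expanded product into [b * (p + q) * a], which
    cancels the linear terms. *)
Lemma mul_sandwich_sub1 (R : pzRingType) (a b p q : R) :
  p * (a * b) * q = p + q -> (b * p * a - 1) * (b * q * a - 1) = 1.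
Proof.
move=> pq; rewrite mulrBl mul1r mulrBr mulr1.
have -> : b * p * a * (b * q * a) = b * (p * (a * b) * q) * a.
  by rewrite !mulrA.
by rewrite pq mulrDr mulrDl [b * p * a + _]addrC addrK opprB addrC subrK.
Qed.

Theorem theorem2p5 (R : pzRingType) (a b : R) :
  strongly_clean (a * b) -> strongly_clean (b * a).
Proof.
case=> e [ee ex [w [wu uw]]]; set x := a * b in ex wu uw.
have eu : e * (x - e) = (x - e) * e by rewrite mulrBr mulrBl ex.
have ew : e * w = w * e.
  by rewrite -[e * w]mul1r -wu -mulrA [_ * (e * w)]mulrA -eu -mulrA uw mulr1.
have xw : x * w = 1 + e * w by rewrite -uw -mulrDl subrK.
have wx : w * x = 1 + e * w by rewrite ew -wu -mulrDr subrK.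
have fe : (1 - e) * e = 0 by rewrite mulrBl mul1r ee subrr.
have ef : e * (1 - e) = 0 by rewrite mulrBr mulr1 ee subrr.
have ff : (1 - e) * (1 - e) = 1 - e by rewrite {1}mulrBl mul1r ef subr0.
pose c := (1 - e) * w.
have cE : c = w * (1 - e) by rewrite /c mulrBl mulrBr mul1r mulr1 ew.
have cx : c * x = 1 - e by rewrite /c -mulrA wx mulrDr mulr1 mulrA fe mul0r addr0.
have xc : x * c = 1 - e.
  by rewrite cE mulrA xw mulrDl mul1r ew -mulrA ef mulr0 addr0.
have fc : (1 - e) * c = c by rewrite /c mulrA ff.
have ec : e * c = 0 by rewrite /c mulrA ef mul0r.
have cw : c * w = w * c by rewrite {1}cE /c mulrA.
(* As [e] kills [c], only [1 + e * w + c] survives, and [e * w] and [c = (1 - e) * w] add up to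
   [w]. *)
have xwc : x * (w * (1 + c)) = 1 + w.
  rewrite mulrA xw mulrDr mulr1 mulrDl mul1r ew -mulrA ec mulr0 addr0 -ew.
  by rewrite /c mulrBl mul1r -addrA [e * w + _]addrC subrK.
have wcx : w * (1 + c) * x = 1 + w.
  rewrite -mulrA mulrDl mul1r cx mulrDr wx mulrBr mulr1 -ew.
  by rewrite -addrA [e * w + _]addrC subrK.
(* [pxq] and [qxp] feed [mul_sandwich_sub1] in both orders, one for each side of the inverse. *)
have pxq : (1 + c) * x * (w * (1 + c)) = 1 + c + w * (1 + c).
  by rewrite -mulrA xwc mulrDr mulr1 mulrDl mul1r cw mulrDr mulr1.
have qxp : w * (1 + c) * x * (1 + c) = w * (1 + c) + (1 + c).
  by rewrite wcx mulrDl mul1r addrC.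
have gg : b * c * a * (b * c * a) = b * c * a.
  have -> : b * c * a * (b * c * a) = b * (c * x * c) * a by rewrite !mulrA.
  by rewrite cx fc.
have uE : b * a - (1 - b * c * a) = b * (1 + c) * a - 1.
  by rewrite mulrDr mulr1 mulrDl opprB addrA.
exists (1 - b * c * a); split.
- by rewrite mulrBr mulr1 mulrBl mul1r gg subrr subr0.
- rewrite mulrBl mulrBr mul1r mulr1; congr (_ - _).
  (* Both products equal [b * (1 - e) * a], because [c * x] and [x * c] are both [1 - e]. *)
  have -> : b * c * a * (b * a) = b * (c * x) * a by rewrite !mulrA.
  by rewrite cx -xc !mulrA.
- exists (b * (w * (1 + c)) * a - 1).
  by rewrite uE; split; apply: mul_sandwich_sub1.
Qed.
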